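(* Let $(M,\alpha)$ be a strict contact manifold with contact structure $\xi=\ker\alpha$ and Reeb vector field $R_\alpha$. There is a one-to-one correspondence between contact vector fields $X$ on $(M,\alpha)$ and smooth functions $H: M\to\mathbb{R}$, given by the following mutually inverse assignments: (1) $X\mapsto H_X=\alpha(X)$; (2) $H\mapsto X_H$, where $X_H$ is the vector field defined by the conditions $\alpha(X_H)=H$ and $\iota_{X_H}d\alpha = dH(R_\alpha)\,\alpha-dH$.
   Context: A strict contact manifold $(M,\alpha)$ is a $(2n+1)$-dimensional smooth manifold $M$ with a smooth 1-form $\alpha$ (contact form) such that $\alpha\wedge(d\alpha)^n$ is nowhere zero. The Reeb vector field $R_\alpha$ is the unique vector field with $\iota_{R_\alpha}d\alpha=0$ and $\alpha(R_\alpha)=1$. A vector field $X$ on $M$ is a contact vector field if its (local) flow $\psi_t$ satisfies $T\psi_t(\xi)=\xi$ for all $t$ for which it is defined; equivalently, there is a smooth function $\mu:M\to\mathbb{R}$ with $\mathcal{L}_X\alpha=\mu\alpha$. *)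

(* Defs.v *)
From HB Require Import structures.
From mathcomp Require Export all_boot all_order all_algebra perm.
From mathcomp Require Export all_classical all_reals all_analysis.
Set Implicit Arguments.
Unset Strict Implicit.
Unset Printing Implicit Defensive.
Import Order.TTheory GRing.Theory Num.Theory.
Import numFieldNormedType.Exports.
Local Open Scope classical_set_scope.
Local Open Scope ring_scope.

(* C^k on an open set U, stated on functions that are total but only meaningful
   on U: since U is open, the conditions only see the values of f on U. *)
Fixpoint Ck (R : realType) (V W : normedModType R) (k : nat) (U : set V)
    (f : V -> W) : Prop :=
  match k with
  | 0 => forall x, U x -> {for x, continuous f}
  | k'.+1 => (forall x, U x -> differentiable f x) /\
             (forall v, Ck k' U ('D_v f))
  end.

Definition smooth_on (R : realType) (V W : normedModType R) (U : set V)
  (f : V -> W) : Prop := forall k, Ck k U f.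

Record chart (R : realType) (m : nat) (T : topologicalType) := Chart {
  cdom : set T;
  ccod : set 'rV[R]_m;
  cto : T -> 'rV[R]_m;
  cfrom : 'rV[R]_m -> T;
  cdom_open : open cdom;
  ccod_open : open ccod;
  cto_cod : forall p, cdom p -> ccod (cto p);
  cfrom_dom : forall x, ccod x -> cdom (cfrom x);
  ctoK : forall p, cdom p -> cfrom (cto p) = p;
  cfromK : forall x, ccod x -> cto (cfrom x) = x;
  cto_continuous : forall p, cdom p -> {for p, continuous cto};
  cfrom_continuous : forall x, ccod x -> {for x, continuous cfrom} }.

(* The coordinate change from c to d, meaningful on the open set [trans_dom]. *)
Definition trans (R : realType) (m : nat) (T : topologicalType)
  (c d : chart R m T) : 'rV[R]_m -> 'rV[R]_m := cto d \o cfrom c.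
Definition trans_dom (R : realType) (m : nat) (T : topologicalType)
  (c d : chart R m T) : set 'rV[R]_m := ccod c `&` (cfrom c @^-1` cdom d).

(* The charts [atlas i] form an atlas (not required to be maximal); [pref p]
   selects a preferred chart around p, so in particular the charts cover. *)
Record smoothManifold (R : realType) (m : nat) := SmoothManifold {
  carrier :> topologicalType;
  carrier_hausdorff : hausdorff_space carrier;
  carrier_second_countable : @second_countable carrier;
  atlas_index : Type;
  atlas : atlas_index -> chart R m carrier;
  trans_smooth : forall i j,
    smooth_on (trans_dom (atlas i) (atlas j)) (trans (atlas i) (atlas j));
  pref : carrier -> atlas_index;
  pref_dom : forall p, cdom (atlas (pref p)) p }.

Section Calculus.
Variables (R : realType) (m : nat) (M : smoothManifold R m).
Implicit Types (p : M) (i j : atlas_index M) (x v u : 'rV[R]_m).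

Definition pref_chart p := atlas (pref p).
Definition pref_pt p : 'rV[R]_m := cto (pref_chart p) p.

Definition is_smooth (f : M -> R) : Prop :=
  forall i, smooth_on (ccod (atlas i)) (f \o cfrom (atlas i)).

Record smoothFun := SmoothFun {
  sfun :> M -> R;
  sfun_smooth : is_smooth sfun }.

(* The tangent space T_pM is R^m: a vector v at p stands for the tangent vector
   whose components in the preferred chart of p are v, and its components in
   another chart are obtained from the differential of the coordinate change.
   A vector field is thus a map M -> R^m, a 1-form a map M -> R^m -> R linear in
   its second argument. *)

(* Components, in chart i and as functions of the coordinate x, of a vector
   field X. *)
Definition vf_in i (X : M -> 'rV[R]_m) (x : 'rV[R]_m) : 'rV[R]_m :=
  let p := cfrom (atlas i) x in
  'd (trans (pref_chart p) (atlas i)) (pref_pt p) (X p).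

Record vectorField := VectorField {
  vfield :> M -> 'rV[R]_m;
  vfield_smooth : forall i, smooth_on (ccod (atlas i)) (vf_in i vfield) }.

(* Value, in chart i at the coordinate x, of the 1-form alpha on the tangent
   vector whose components in chart i are v. *)
Definition form_in i (alpha : M -> 'rV[R]_m -> R) (v x : 'rV[R]_m) : R :=
  let p := cfrom (atlas i) x in
  alpha p ('d (trans (atlas i) (pref_chart p)) x v).

Record oneForm := OneForm {
  oform :> M -> 'rV[R]_m -> R;
  oform_linear : forall p (a : R) (u v : 'rV[R]_m),
    oform p (a *: u + v) = a * oform p u + oform p v;
  oform_smooth : forall i v,
    smooth_on (ccod (atlas i)) (form_in i oform v) }.

Definition dfun (f : M -> R) p v : R :=
  'd (f \o cfrom (pref_chart p)) (pref_pt p) v.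

(* d alpha (u, v) = u(alpha(v)) - v(alpha(u)) for constant u, v in a chart, i.e.
   (d alpha)_{jk} = d_j alpha_k - d_k alpha_j. *)
Definition dform (alpha : oneForm) p u v : R :=
  'D_u (form_in (pref p) alpha v) (pref_pt p)
  - 'D_v (form_in (pref p) alpha u) (pref_pt p).

(* The coordinate expression of d/dt psi_t^* alpha at t = 0, for psi_t the flow
   of X: (L_X alpha)_k = X^j d_j alpha_k + alpha_j d_k X^j. *)
Definition lie_derivative (X : vectorField) (alpha : oneForm) p v : R :=
  'D_(X p) (form_in (pref p) alpha v) (pref_pt p)
  + alpha p ('D_v (vf_in (pref p) X) (pref_pt p)).

End Calculus.

(* Only applied to alternating multilinear maps. The wedge product is normalised
   so that e_1^* /\ ... /\ e_k^* is the determinant. *)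
Definition multiform (R : realType) (V : Type) (k : nat) := ('I_k -> V) -> R.

Definition wedge (R : realType) (V : Type) (k l : nat)
    (a : multiform R V k) (b : multiform R V l) : multiform R V (k + l) :=
  fun w => ((k`! * l`!)%:R)^-1 *
    \sum_(s : 'S_(k + l)) (-1) ^+ (odd_perm s) *
      (a (fun i => w (s (lshift l i))) * b (fun j => w (s (rshift k j)))).

Fixpoint wedge_exp (R : realType) (V : Type) (k : nat) (a : multiform R V k)
    (n : nat) : multiform R V (n * k) :=
  match n with
  | 0 => fun _ => 1
  | n'.+1 => wedge a (@wedge_exp R V k a n')
  end.
Arguments wedge_exp {R V k} a n : rename.

Section Contact.
Variables (R : realType) (n : nat) (M : smoothManifold R n.*2.+1).
Implicit Types (alpha : oneForm M) (X Y Rb : vectorField M) (H : smoothFun M).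

Definition form1 alpha (p : M) : multiform R 'rV[R]_n.*2.+1 1 :=
  fun w => alpha p (w ord0).
Definition form2 alpha (p : M) : multiform R 'rV[R]_n.*2.+1 2 :=
  fun w => dform alpha p (w ord0) (w ord_max).

Definition is_contact_form alpha : Prop :=
  forall p : M, exists w : 'I_(1 + n * 2) -> 'rV[R]_n.*2.+1,
    wedge (form1 alpha p) (wedge_exp (form2 alpha p) n) w != 0.

Definition is_reeb alpha Rb : Prop :=
  forall p : M, (forall v : 'rV[R]_n.*2.+1, dform alpha p (Rb p) v = 0) /\
                alpha p (Rb p) = 1.

Definition is_contact_field alpha X : Prop :=
  exists mu : smoothFun M, forall (p : M) (v : 'rV[R]_n.*2.+1),
    lie_derivative X alpha p v = mu p * alpha p v.

Definition contactField alpha : Type :=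
  {X : vectorField M | is_contact_field alpha X}.

Definition is_hamiltonian_field alpha Rb H X : Prop :=
  forall p : M, alpha p (X p) = H p /\
    forall v : 'rV[R]_n.*2.+1,
      dform alpha p (X p) v = dfun H p (Rb p) * alpha p v - dfun H p v.

End Contact.

(* Main.v *)
From mathcomp Require Import ring.
Require Import Defs.
Set Implicit Arguments.
Unset Strict Implicit.
Unset Printing Implicit Defensive.
Import Order.TTheory GRing.Theory Num.Theory.
Import numFieldNormedType.Exports.
Local Open Scope classical_set_scope.
Local Open Scope ring_scope.

(** The correspondence rests on two facts about a contact form alpha.

    The first is the Cartan formula
    L_X alpha = i_X (d alpha) + d (alpha(X)) ([lie_derivative_cartan]). If X is
    a contact field, L_X alpha = mu alpha, then evaluating on the Reeb field
    R kills the first term (d alpha (X, R) = 0) and gives mu = dH(R) for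
    H = alpha(X); hence i_X (d alpha) = dH(R) alpha - dH, which says that X is
    the Hamiltonian field of its own H ([contact_hamiltonian]). Reading the
    same formula backwards, a Hamiltonian field of H satisfies
    L_X alpha = dH(R) alpha, and is therefore a contact field
    ([hamiltonian_contact]).

    The second is pointwise nondegeneracy ([contact_nondegenerate]): a vector
    killed both by alpha and by d alpha vanishes. Otherwise it would be killed
    by every factor of alpha /\ (d alpha)^n, hence by this product, and an
    alternating form of top degree that kills a nonzero vector is zero
    ([top_form_killed]). This gives uniqueness of the Hamiltonian field at
    once. For existence, the bilinear pairing
    B(u, v) = alpha(u) alpha(v) + d alpha (u, v) is nondegenerate, so
    B(X, .) = H alpha + dH(R) alpha - dH has exactly one solution X at each
    point; evaluating on R yields alpha(X) = H, and subtracting H alpha leaves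
    the second Hamilton condition ([hamilton_field_is_hamiltonian]).

    Smoothness of this pointwise solution is checked in an arbitrary chart:
    there X is a row of smooth functions times the inverse of the Gram matrix
    of B, and inverses of smooth matrices are smooth by Cramer's rule
    ([smooth_invmx]). For the Gram matrix to be smooth in a chart, d alpha,
    which is defined at each point through the preferred chart of that point,
    has to be given by the same formula in every chart ([dform_in_jac]). This
    is where the symmetry of second derivatives of coordinate changes enters
    ([derive_comm]). *)

(** * Smooth functions on an open set *)

Section SmoothCalculus.
Variable R : realType.
Implicit Types V W : normedModType R.

(** The difference g - f vanishes near x, so it is differentiable there with
    zero differential. *)
Lemma near_eq_differentiable V W (f g : V -> W) (x : V) :
  (\near x, f x = g x) -> differentiable f x -> differentiable g x.
Proof.
move=> fg df.
pose h : V -> W := g - f.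
have h0 : \near x, h x = 0.
  by near=> y; rewrite -[LHS]/(g y - f y) (near fg y)// subrr.
have hx : h x = 0 by exact: nbhs_singleton h0.
have eh : h \o shift x = cst (h x) + (\0 : V -> W) +o_ 0 id.
  rewrite hx; apply/eqaddoP => e e0; near=> y.
  have hy : h (y + x) = 0.
    by near: y; move: h0; rewrite (near_shift 0 x) subr0.
  rewrite -[X in `|X|]/(h (y + x) - (0 + 0)) hy addr0 subrr normr0.
  by rewrite mulr_ge0 // ltW.
have cz : continuous (\0 : V -> W) by exact: cst_continuous.
have dh : differentiable h x.
  by apply/diff_locallyP; rewrite (diff_unique cz eh).
have -> : g = f + h.
  by apply/funext => y; rewrite /h -[RHS]/(f y + (g y - f y)) addrC subrK.
exact: differentiableD.
Unshelve. all: by end_near. Qed.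

(** Makes it possible to replace a function by a formula valid only on U. *)
Lemma Ck_ext V W (U : set V) (f g : V -> W) k : open U ->
  (forall x, U x -> f x = g x) -> Ck k U f -> Ck k U g.
Proof.
move=> oU; elim: k f g => [|k IH] f g fg.
  move=> cf x Ux /=; have n : \near x, f x = g x.
    by apply: filterS (open_nbhs_nbhs (conj oU Ux)).
  have := cf x Ux; rewrite /prop_for /continuous_at -(fg x Ux).
  apply: cvg_trans; exact: near_eq_cvg.
have n x : U x -> \near x, f x = g x.
  by move=> Ux; apply: filterS (open_nbhs_nbhs (conj oU Ux)).
move=> [df Df]; split=> [x Ux|v].
  by apply: near_eq_differentiable (df x Ux); exact: n.
by apply: IH (Df v) => x Ux; apply: near_eq_derive; exact: n.
Qed.

Lemma CkW V W (U : set V) (f : V -> W) k : Ck k.+1 U f -> Ck k U f.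
Proof.
elim: k f => [|k IH] f [df Df].
  by move=> x Ux; apply: differentiable_continuous; exact: df.
by split=> // v; exact: IH.
Qed.

Lemma Ck_cst V W (U : set V) (w : W) k : Ck k U (cst w : V -> W).
Proof.
elim: k w => [|k IH] w; first by move=> x _; exact: cst_continuous.
split=> [x _|v]; first exact: differentiable_cst.
by rewrite (_ : 'D_v _ = cst 0) //; apply/funext => x; rewrite derive_cst.
Qed.

Lemma Ck_add V W (U : set V) (f g : V -> W) k : open U ->
  Ck k U f -> Ck k U g -> Ck k U (f + g).
Proof.
move=> oU; elim: k f g => [|k IH] f g.
  by move=> cf cg x Ux; apply: continuousD; [exact: cf|exact: cg].
move=> [df Df] [dg Dg]; split=> [x Ux|v].
  by apply: differentiableD; [exact: df|exact: dg].
apply: (Ck_ext oU _ (IH _ _ (Df v) (Dg v))) => x Ux.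
by rewrite deriveD//; apply: diff_derivable; [exact: df|exact: dg].
Qed.

Lemma Ck_mul V (U : set V) (f g : V -> R) k : open U ->
  Ck k U f -> Ck k U g -> Ck k U (f * g).
Proof.
move=> oU; elim: k f g => [|k IH] f g.
  by move=> cf cg x Ux; apply: continuousM; [exact: cf|exact: cg].
move=> Cf Cg; have [df Df] := Cf; have [dg Dg] := Cg; split=> [x Ux|v].
  by apply: differentiableM; [exact: df|exact: dg].
apply: (@Ck_ext _ _ _ (f * 'D_v g + g * 'D_v f) _ _ oU) => [x Ux|].
  by rewrite deriveM//; apply: diff_derivable; [exact: df|exact: dg].
by apply: Ck_add => //; apply: IH;
  [exact: CkW Cf|exact: Dg|exact: CkW Cg|exact: Df].
Qed.

Lemma Ck_scale V W (U : set V) (f : V -> R) (w : W) k : open U ->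
  Ck k U f -> Ck k U (fun x => f x *: w).
Proof.
move=> oU; elim: k f => [|k IH] f.
  by by move=> cf x Ux; apply: cvgZr_tmp; exact: cf.
move=> [df Df]; split=> [x Ux|v].
  exact: differentiableZl (df x Ux).
apply: (Ck_ext oU _ (IH _ (Df v))) => x Ux.
have dfx := df x Ux.
rewrite [RHS]deriveE; last exact: differentiableZl.
by rewrite diffZl//= deriveE.
Qed.

Lemma Ck_inv V (U : set V) (f : V -> R) k : open U ->
  (forall x, U x -> f x != 0) -> Ck k U f -> Ck k U (fun x => (f x)^-1).
Proof.
move=> oU f0; elim: k => [|k IH].
  by move=> cf x Ux; apply: cvgV; [exact: f0|exact: cf].
move=> Cf; have [df Df] := Cf; split=> [x Ux|v].
  by apply: differentiableV; [exact: df|exact: f0].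
pose g : V -> R := fun x => (f x)^-1.
have Cg : Ck k U g by apply: IH; exact: CkW.
apply: (@Ck_ext _ _ _ (cst (-1) * (g * g) * 'D_v f) _ _ oU) => [x Ux|].
  rewrite [RHS]deriveV; [|exact: f0|by apply: diff_derivable; exact: df].
  by rewrite -[LHS]/(-1 * (g x * g x) * 'D_v f x) /g mulN1r -invfM -expr2.
by apply: Ck_mul (Df v) => //; apply: Ck_mul => //; [exact: Ck_cst|exact: Ck_mul].
Qed.

Lemma Ck_coord V m n (U : set V) (f : V -> 'M[R]_(m, n)) k i j : open U ->
  Ck k U f -> Ck k U (fun x => f x i j : R).
Proof.
move=> oU; elim: k f => [|k IH] f.
  move=> cf x Ux.
  apply: (@continuous_comp _ _ _ f (fun M : 'M[R]_(m, n) => M i j)).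
    exact: cf.
  exact: coord_continuous.
move=> [df Df]; split=> [x Ux|v].
  apply: (@differentiable_comp _ _ _ _ f (fun M : 'M[R]_(m, n) => M i j : R)).
    exact: df.
  exact: differentiable_coord.
apply: (Ck_ext oU _ (IH _ (Df v))) => x Ux.
by rewrite derive_mx ?mxE//; apply: diff_derivable; exact: df.
Qed.


Lemma smooth_ext V W (U : set V) (f g : V -> W) : open U ->
  (forall x, U x -> f x = g x) -> smooth_on U f -> smooth_on U g.
Proof. by move=> oU fg sf k; exact: (Ck_ext oU fg (sf k)). Qed.

Lemma smooth_differentiable V W (U : set V) (f : V -> W) x :
  smooth_on U f -> U x -> differentiable f x.
Proof. by move=> /(_ 1%N) [df _]; exact: df. Qed.

Lemma smooth_derive V W (U : set V) (f : V -> W) v :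
  smooth_on U f -> smooth_on U ('D_v f).
Proof. by move=> sf k; have [_ sDf] := sf k.+1; exact: sDf. Qed.

Lemma smooth_cst V W (U : set V) (w : W) : smooth_on U (fun _ : V => w).
Proof. by move=> k; exact: Ck_cst. Qed.

Lemma smooth_add V W (U : set V) (f g : V -> W) : open U ->
  smooth_on U f -> smooth_on U g -> smooth_on U (fun x => f x + g x).
Proof. by move=> oU sf sg k; exact: Ck_add. Qed.

Lemma smooth_mul V (U : set V) (f g : V -> R) : open U ->
  smooth_on U f -> smooth_on U g -> smooth_on U (fun x => f x * g x).
Proof. by move=> oU sf sg k; exact: Ck_mul. Qed.

Lemma smooth_scale V W (U : set V) (f : V -> R) (w : W) : open U ->
  smooth_on U f -> smooth_on U (fun x => f x *: w).
Proof. by move=> oU sf k; exact: Ck_scale. Qed.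

Lemma smooth_inv V (U : set V) (f : V -> R) : open U ->
  (forall x, U x -> f x != 0) -> smooth_on U f ->
  smooth_on U (fun x => (f x)^-1).
Proof. by move=> oU f0 sf k; exact: Ck_inv. Qed.

Lemma smooth_sub V (U : set V) (f g : V -> R) : open U ->
  smooth_on U f -> smooth_on U g -> smooth_on U (fun x => f x - g x).
Proof.
move=> oU sf sg; apply: (@smooth_ext _ _ _ (fun x => f x + (-1) * g x)) => //.
  by move=> x _; rewrite mulN1r.
by apply: smooth_add => //; apply: smooth_mul => //; exact: smooth_cst.
Qed.

Lemma smooth_sum V W (U : set V) (I : Type) (r : seq I) (F : I -> V -> W) :
  open U -> (forall i, smooth_on U (F i)) ->
  smooth_on U (fun x => \sum_(i <- r) F i x).
Proof.
move=> oU sF; elim: r => [|i r IH].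
  apply: (@smooth_ext _ _ _ (fun _ : V => 0)) => //; last exact: smooth_cst.
  by move=> x _; rewrite big_nil.
apply: (@smooth_ext _ _ _ (fun x => F i x + \sum_(j <- r) F j x)) => //.
  by move=> x _; rewrite big_cons.
exact: smooth_add.
Qed.

Lemma smooth_prod V (U : set V) (I : Type) (r : seq I) (F : I -> V -> R) :
  open U -> (forall i, smooth_on U (F i)) ->
  smooth_on U (fun x => \prod_(i <- r) F i x).
Proof.
move=> oU sF; elim: r => [|i r IH].
  apply: (@smooth_ext _ _ _ (fun _ : V => 1 : R)) => //; last exact: smooth_cst.
  by move=> x _; rewrite big_nil.
apply: (@smooth_ext _ _ _ (fun x => F i x * \prod_(j <- r) F j x)) => //.
  by move=> x _; rewrite big_cons.
exact: smooth_mul.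
Qed.

Lemma smooth_coord V m n (U : set V) (f : V -> 'M[R]_(m, n)) i j : open U ->
  smooth_on U f -> smooth_on U (fun x => f x i j : R).
Proof. by move=> oU sf k; exact: Ck_coord. Qed.

Lemma smooth_mx V m n (U : set V) (f : V -> 'M[R]_(m, n)) : open U ->
  (forall i j, smooth_on U (fun x => f x i j : R)) -> smooth_on U f.
Proof.
move=> oU sf.
apply: (@smooth_ext _ _ _ (fun x => \sum_i \sum_j f x i j *: delta_mx i j)) => //.
  by move=> x _; rewrite -matrix_sum_delta.
do 2!apply: smooth_sum => // ?.
exact: smooth_scale.
Qed.

Lemma smooth_det V n (U : set V) (A : V -> 'M[R]_n) : open U ->
  (forall i j, smooth_on U (fun x => A x i j)) ->
  smooth_on U (fun x => \det (A x)).
Proof.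
move=> oU sA; apply: smooth_sum => // s; apply: smooth_mul => //.
  exact: smooth_cst.
by apply: smooth_prod => // i; exact: sA.
Qed.

(** Entries of the inverse are cofactors over the determinant. *)
Lemma smooth_invmx V n (U : set V) (A : V -> 'M[R]_n) : open U ->
  (forall x, U x -> A x \in unitmx) ->
  (forall i j, smooth_on U (fun x => A x i j)) ->
  forall i j, smooth_on U (fun x => invmx (A x) i j).
Proof.
move=> oU uA sA i j.
apply: (@smooth_ext _ _ _ (fun x => (\det (A x))^-1 * cofactor (A x) j i)) => //.
  by move=> x Ux; rewrite /invmx uA// !mxE.
apply: smooth_mul => //; last first.
  apply: smooth_mul => //; first exact: smooth_cst.
  apply: smooth_det => // a b; apply: smooth_ext (sA (lift j a) (lift i b)) => //.
  by move=> x _; rewrite !mxE.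
apply: smooth_inv => //; last exact: smooth_det.
by move=> x Ux; have := uA x Ux; rewrite unitmxE unitfE.
Qed.

Lemma smooth_mulmx V m n p (U : set V) (A : V -> 'M[R]_(m, n))
    (B : V -> 'M[R]_(n, p)) : open U ->
  (forall i j, smooth_on U (fun x => A x i j)) ->
  (forall i j, smooth_on U (fun x => B x i j)) ->
  forall i j, smooth_on U (fun x => (A x *m B x) i j).
Proof.
move=> oU sA sB i j.
apply: (@smooth_ext _ _ _ (fun x => \sum_k A x i k * B x k j)) => //.
  by move=> x _; rewrite mxE.
by apply: smooth_sum => // k; exact: smooth_mul.
Qed.

End SmoothCalculus.

(** * Symmetry of second derivatives *)

Section Schwarz.
Variables (R : realType) (V : normedModType R).
Implicit Types (f : V -> R) (u v a x : V).

(** The difference quotients of the restriction of f to a line are literally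
    those of f in the direction of that line. *)
Lemma is_derive_line f a u (s : R) : differentiable f (s *: u + a) ->
  is_derive s 1 (fun t => f (t *: u + a)) ('D_u f (s *: u + a)).
Proof.
move=> /(@diff_derivable _ _ _ _ _ u) df.
have E : (fun h : R => h^-1 *: (((fun t => f (t *: u + a)) \o shift s) (h *: 1)
                                - f (s *: u + a)))
  = (fun h => h^-1 *: ((f \o shift (s *: u + a)) (h *: u) - f (s *: u + a))).
  by apply/funext => h /=; rewrite [_ *: 1]mulr1 scalerDl addrA.
by apply: DeriveDef; [rewrite /derivable E|rewrite /derive E].
Qed.

Lemma approximants_close (e s d d' b b' : R) : 0 < s ->
  `|d - s * b| <= e / 2 * s -> `|d' - s * b'| <= e / 2 * s -> d' = d ->
  `|b - b'| <= e.
Proof.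
move=> s0 h h' dd; rewrite -(ler_pM2l s0) -{1}(gtr0_norm s0) -normrM.
have -> : s * (b - b') = (d' - s * b') - (d - s * b) by rewrite dd; ring.
apply: (le_trans (ler_normB _ _)); apply: (le_trans (lerD h' h)).
by rewrite -mulrDl -splitr mulrC.
Qed.

(** The mean value theorem applied to s |-> f (s u + t v + x) - f (s u + x) on
    [0, t] turns the second difference into t times an increment of D_u f
    between two points at distance O(t) of x; the expansion of D_u f at x to
    first order then gives t^2 D_v D_u f (x) up to o(t^2). *)
Lemma second_difference_near f (U : set V) x u v (e : R) : open U -> U x ->
  (forall y, U y -> differentiable f y) -> differentiable ('D_u f) x ->
  0 < e ->
  \forall t \near 0^'+,
    `|f (t *: u + (t *: v + x)) - f (t *: u + x) - f (t *: v + x) + f x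
      - t ^+ 2 * 'D_v ('D_u f) x| <= e * t ^+ 2.
Proof.
move=> oU Ux df dg e0.
(* C t bounds the norm of c u + b v for c, b in [0, t]; the final + 1 makes C
   positive even if u = v = 0. The two expansions used below each contribute
   an error C t times the chosen precision, whence e / (C + C). *)
set g := 'D_u f; pose C := `|u| + `|v| + 1.
have C0 : 0 < C by rewrite (lt_le_trans ltr01)// lerDr addr_ge0.
have eC : 0 < e / (C + C) by apply: divr_gt0 => //; exact: addr_gt0.
have /diff_locallyP[_ /eqaddoP/(_ _ eC) gx] := dg.
have Ux0 : \forall h \near 0, U (h + x).
  have : \near x, U x by exact: open_nbhs_nbhs (conj oU Ux).
  by rewrite (near_shift 0 x) subr0.
have /nbhs_ballP[d /= d0 dP] : nbhs (0 : V) (fun h =>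
    `|g (h + x) - (g x + 'd g x h)| <= e / (C + C) * `|h| /\ U (h + x)).
  by apply: filterS2 Ux0 gx => h Uh gh; split.
near=> t.
have t0 : 0 < t by [].
have tC : t * C < d.
  rewrite -ltr_pdivlMr//; near: t; apply: nbhs_right_lt.
  by rewrite divr_gt0.
have small (c b : R) : 0 <= c <= t -> 0 <= b <= t ->
    `|c *: u + b *: v| <= t * C.
  move=> /andP[c0 ct] /andP[b0 bt].
  rewrite (le_trans (ler_normD _ _))// !normrZ !ger0_norm//.
  rewrite /C !mulrDr mulr1 -[leLHS]addr0; apply: lerD; last exact: ltW.
  by apply: lerD; apply: ler_wpM2r.
have inb (c b : R) : 0 <= c <= t -> 0 <= b <= t ->
    ball (0 : V) d (c *: u + b *: v).
  move=> hc hb; rewrite -ball_normE /ball_/= sub0r normrN.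
  exact: le_lt_trans (small _ _ hc hb) tC.
have tt : 0 <= t <= t by rewrite lexx ltW.
have zt : (0 : R) <= 0 <= t by rewrite lexx ltW.
pose phi s := f (s *: u + (t *: v + x)) - f (s *: u + x).
pose dphi s := g (s *: u + (t *: v + x)) - g (s *: u + x).
have Uc c : 0 <= c <= t -> U (c *: u + (t *: v + x)) /\ U (c *: u + x).
  move=> hc; split; first by rewrite addrA; have [] := dP _ (inb c t hc tt).
  by have [] := dP _ (inb c 0 hc zt); rewrite scale0r addr0.
have dp c : 0 <= c <= t -> is_derive c 1 phi (dphi c).
  by move=> /Uc[U1 U2]; apply: is_deriveB; apply: is_derive_line; exact: df.
have [c||c /[!in_itv]/= /andP[c0 ct]] := @MVT R phi dphi 0 t t0.
- by rewrite in_itv/= => /andP[c0 ct]; apply: dp; rewrite !ltW.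
- apply: derivable_within_continuous => s /[!in_itv]/= st.
  by have dps := dp s st; exact: ex_derive.
rewrite subr0 {1 2}/phi !scale0r !add0r => E.
have hc : 0 <= c <= t by rewrite !ltW.
have -> : f (t *: u + (t *: v + x)) - f (t *: u + x) - f (t *: v + x) + f x
   = dphi c * t.
  by rewrite -E; ring.
have [g1 _] := dP _ (inb c t hc tt).
have [g2 _] := dP _ (inb c 0 hc zt).
have EL : 'D_v g x = 'd g x v by rewrite deriveE.
have -> : dphi c * t - t ^+ 2 * 'D_v g x =
    t * ((g (c *: u + t *: v + x) - (g x + 'd g x (c *: u + t *: v)))
       - (g (c *: u + 0 *: v + x) - (g x + 'd g x (c *: u + 0 *: v)))).
  have L (b : R) : 'd g x (c *: u + b *: v) = c * 'd g x u + b * 'd g x v.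
    by rewrite linearD !linearZ.
  rewrite EL /dphi !L addrA scale0r addr0.
  have E5 (s a1 a2 a3 a4 a5 : R) : (a3 - a4) * t - t ^+ 2 * a2 =
    t * (a3 - (a5 + (s * a1 + t * a2)) - (a4 - (a5 + (s * a1 + 0 * a2)))).
    by ring.
  exact: E5.
rewrite normrM gtr0_norm// expr2 mulrCA ler_pM2l//.
rewrite (le_trans (ler_normB _ _))//.
rewrite (le_trans (lerD g1 g2))// -mulrDr.
rewrite (@le_trans _ _ (e / (C + C) * (t * C + t * C)))//.
  by rewrite ler_pM2l//; apply: lerD; exact: small.
have CC : C + C != 0 by apply: lt0r_neq0; exact: addr_gt0.
have -> : e / (C + C) * (t * C + t * C) = t * e.
  by rewrite -mulrDr [t * _]mulrC mulrA divfK// mulrC.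
by rewrite [t * e]mulrC.
Unshelve. all: by end_near. Qed.

(** The second difference is symmetric in u and v, while its leading term is
    t^2 D_v D_u f in one reading and t^2 D_u D_v f in the other. *)
Lemma derive_comm f (U : set V) x u v : open U -> U x ->
  (forall y, U y -> differentiable f y) ->
  differentiable ('D_u f) x -> differentiable ('D_v f) x ->
  'D_u ('D_v f) x = 'D_v ('D_u f) x.
Proof.
move=> oU Ux df du dv.
apply/eqP; rewrite -subr_eq0 -normr_le0; apply/ler_addgt0Pr => e e0.
rewrite add0r.
have e20 : 0 < e / 2 by apply: divr_gt0.
have huv := second_difference_near v oU Ux df du e20.
have hvu := second_difference_near u oU Ux df dv e20.
have [t [[huvt hvut] t0]] :=
  filter_ex (filterI (filterI huv hvu) (nbhs_right_gt (0 : R))).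
apply: approximants_close hvut huvt _; first exact: exprn_gt0.
by rewrite [t *: u + (t *: v + x)]addrCA [_ - f (t *: u + x) - _]addrAC.
Qed.

End Schwarz.

(** * Differentials between spaces of row vectors *)

Lemma open_near (T : topologicalType) (U : set T) (x : T) :
  open U -> U x -> \near x, U x.
Proof. by move=> oU Ux; apply: open_nbhs_nbhs. Qed.

Section Differentials.
Variable R : realType.

Lemma near_eq_diff (V W : normedModType R) (f g : V -> W) x v :
  (\near x, f x = g x) -> differentiable f x -> 'd f x v = 'd g x v.
Proof.
move=> fg df; rewrite -!deriveE//; first exact: near_eq_derive.
exact: near_eq_differentiable df.
Qed.

Lemma diff_chain (U V W : normedModType R) (f : U -> V) (g : V -> W) x v :
  differentiable f x -> differentiable g (f x) ->
  'd (g \o f) x v = 'd g (f x) ('d f x v).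
Proof. by move=> df dg; rewrite diff_comp. Qed.

(** This instance and the next one mention the structures that are inferred from
    the type of row vectors, so that they apply to coordinate changes without
    unfolding the canonical structures of matrices. *)
Lemma near_eq_diff_rV m n (f g : 'rV[R]_m -> 'rV[R]_n) x v :
  (\near x, f x = g x) -> differentiable f x -> 'd f x v = 'd g x v.
Proof. exact: near_eq_diff. Qed.

Lemma diff_chain_rV m n p (f : 'rV[R]_m -> 'rV[R]_n) (g : 'rV[R]_n -> 'rV[R]_p)
    x v :
  differentiable f x -> differentiable g (f x) ->
  'd (g \o f) x v = 'd g (f x) ('d f x v).
Proof. exact: diff_chain. Qed.

Lemma diff_id (V : normedModType R) (x v : V) : 'd id x v = v.
Proof. by rewrite -deriveE// derive_id. Qed.

Lemma row_linear_expand m (phi : 'rV[R]_m -> R) (v : 'rV[R]_m) :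
  (forall (a : R) u w, phi (a *: u + w) = a * phi u + phi w) ->
  phi v = \sum_k v 0 k * phi (delta_mx 0 k).
Proof.
move=> lphi; have phi0 : phi 0 = 0.
  by have := lphi (-1) 0 0; rewrite scaler0 addr0 mulN1r addNr.
rewrite {1}(row_sum_delta v); elim/big_ind2: _ => //= [a x b y <- <-|k _].
  by rewrite -[x]scale1r lphi mul1r scale1r.
by rewrite -[_ *: _]addr0 lphi phi0 addr0.
Qed.

Lemma derive_linear_dir m (f : 'rV[R]_m -> R) x (a : R) u w :
  differentiable f x -> 'D_(a *: u + w) f x = a * 'D_u f x + 'D_w f x.
Proof. by move=> df; rewrite !deriveE// linearD linearZ. Qed.

Lemma diff_coord m n (f : 'rV[R]_m -> 'rV[R]_n) x v k : differentiable f x ->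
  'd f x v 0 k = 'D_v (fun y => f y 0 k : R) x.
Proof.
move=> df; rewrite -deriveE// derive_mx ?mxE//; exact: diff_derivable.
Qed.

End Differentials.

(** * Coordinate changes *)

Section Charts.
Variables (R : realType) (m : nat) (M : smoothManifold R m).
Implicit Types (p : M) (i j k : atlas_index M) (x v u w : 'rV[R]_m).

Local Notation tr i j := (trans (atlas i) (atlas j)).
Local Notation trd i j := (trans_dom (atlas i) (atlas j)).

Lemma trans_dom_open i j : open (trd i j).
Proof.
rewrite openE => x [cx dx]; apply: filterI.
  exact: (open_near (@ccod_open _ _ _ _) cx).
exact: (cfrom_continuous cx) (open_near (cdom_open _) dx).
Qed.

Lemma near_trans_dom i j x : trd i j x -> \near x, trd i j x.
Proof. exact: open_near (@trans_dom_open i j). Qed.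

Lemma trans_differentiable i j x : trd i j x -> differentiable (tr i j) x.
Proof. exact: smooth_differentiable (trans_smooth _ _). Qed.

Lemma cfrom_trans i j x : trd i j x ->
  cfrom (atlas j) (tr i j x) = cfrom (atlas i) x.
Proof. by move=> [cx dx]; exact: ctoK. Qed.

Lemma trans_domP i j k x : trd i j x -> trd i k x -> trd j k (tr i j x).
Proof.
move=> ijx [_ kx]; split; last by rewrite /preimage/= cfrom_trans.
by have [_ jx] := ijx; exact: cto_cod.
Qed.

Lemma trans_cocycle i j k x : trd i j x -> trd i k x ->
  tr j k (tr i j x) = tr i k x.
Proof. by move=> ijx ikx; rewrite /trans/= ctoK//; case: ijx. Qed.

(** The chain rule, applied to the identity of germs [trans_cocycle]. *)
Lemma diff_trans_cocycle i j k x v : trd i j x -> trd i k x ->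
  'd (tr j k) (tr i j x) ('d (tr i j) x v) = 'd (tr i k) x v.
Proof.
move=> ijx ikx.
have d1 := trans_differentiable ijx.
have d2 := trans_differentiable (trans_domP ijx ikx).
have dc : differentiable (tr j k \o tr i j) x by exact: differentiable_comp.
have N : \near x, (tr j k \o tr i j) x = tr i k x.
  near=> y; apply: trans_cocycle; near: y; exact: near_trans_dom.
refine (eq_trans (esym (diff_chain_rV v d1 d2)) _).
exact: near_eq_diff_rV v N dc.
Unshelve. all: by end_near. Qed.

Lemma diff_trans_id i x v : ccod (atlas i) x -> 'd (tr i i) x v = v.
Proof.
move=> cx; have iix : trd i i x by split => //; exact: cfrom_dom.
have N : \near x, tr i i x = id x.
  near=> y; rewrite /trans/= cfromK//; near: y.
  exact: (open_near (@ccod_open _ _ _ _) cx).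
refine (eq_trans (near_eq_diff_rV v N (trans_differentiable iix)) _).
exact: diff_id.
Unshelve. all: by end_near. Qed.

Lemma pref_pt_ccod p : ccod (pref_chart p) (pref_pt p).
Proof. exact: cto_cod (pref_dom p). Qed.

Lemma cfrom_pref_pt p : cfrom (pref_chart p) (pref_pt p) = p.
Proof. exact: ctoK (pref_dom p). Qed.

(** Since tangent vectors at p are stored through their components in the
    preferred chart of p, this is the isomorphism from components in chart i at
    x to tangent vectors at the point of coordinate x. *)
Definition jac i x : {linear 'rV[R]_m -> 'rV[R]_m} :=
  'd (trans (atlas i) (pref_chart (cfrom (atlas i) x))) x.

Lemma trans_dom_pref i x : ccod (atlas i) x ->
  trd i (pref (cfrom (atlas i) x)) x.
Proof. by move=> cx; split => //; exact: pref_dom. Qed.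

Lemma jac_vf_in i X x : ccod (atlas i) x ->
  jac i x (vf_in i X x) = X (cfrom (atlas i) x).
Proof.
move=> cx; rewrite /jac /vf_in.
set p := cfrom _ x.
have E : cfrom (atlas (pref p)) (pref_pt p) = p by exact: cfrom_pref_pt.
have D : trd (pref p) i (pref_pt p).
  by split; [exact: pref_pt_ccod|rewrite /preimage/= E; exact: cfrom_dom].
have -> : x = tr (pref p) i (pref_pt p) by rewrite /trans/= E cfromK.
rewrite diff_trans_cocycle//.
  by rewrite diff_trans_id//; exact: pref_pt_ccod.
by split; [exact: pref_pt_ccod|rewrite /preimage/= E; exact: pref_dom].
Qed.

(** Together with [jac_vf_in], this says that [vf_in] inverts [jac]. *)
Lemma vf_in_jac i x v X : ccod (atlas i) x ->
  X (cfrom (atlas i) x) = jac i x v ->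
  vf_in i X x = v.
Proof.
move=> cx Xv; rewrite /vf_in Xv /jac.
have ipx := trans_dom_pref cx.
rewrite [pref_pt _](_ : _ = tr i (pref (cfrom (atlas i) x)) x)//.
rewrite diff_trans_cocycle ?diff_trans_id//.
by split => //; exact: cfrom_dom.
Qed.

Lemma jac_inj i x v : ccod (atlas i) x -> jac i x v = 0 -> v = 0.
Proof.
move=> cx v0.
by rewrite -(@vf_in_jac i x v (fun=> 0)) ?v0// /vf_in linear0.
Qed.

Lemma jac_surj i x v : ccod (atlas i) x -> exists u, jac i x u = v.
Proof. by move=> cx; exists (vf_in i (fun=> v) x); rewrite jac_vf_in. Qed.

Lemma jac_pref p v : jac (pref p) (pref_pt p) v = v.
Proof. by rewrite /jac cfrom_pref_pt diff_trans_id//; exact: pref_pt_ccod. Qed.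

Lemma vf_in_pref X p : vf_in (pref p) X (pref_pt p) = X p.
Proof.
by apply: vf_in_jac; rewrite ?jac_pref ?cfrom_pref_pt//; exact: pref_pt_ccod.
Qed.

(** * One-forms in charts *)

Section Forms.
Variable alpha : oneForm M.

Lemma form_in_jac i v x :
  form_in i alpha v x = alpha (cfrom (atlas i) x) (jac i x v).
Proof. by []. Qed.

Lemma form_in_linear i (a : R) u v x :
  form_in i alpha (a *: u + v) x = a * form_in i alpha u x + form_in i alpha v x.
Proof. by rewrite /form_in linearD linearZ oform_linear. Qed.

Lemma form_in_pref p v : form_in (pref p) alpha v (pref_pt p) = alpha p v.
Proof. by rewrite form_in_jac jac_pref cfrom_pref_pt. Qed.

Lemma form_in_expand i v x : form_in i alpha v x =
  \sum_k v 0 k * form_in i alpha (delta_mx 0 k) x.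
Proof.
by apply: (row_linear_expand v (phi := form_in i alpha ^~ x)) => a u w;
  exact: form_in_linear.
Qed.

Lemma form_in_differentiable i v x : ccod (atlas i) x ->
  differentiable (form_in i alpha v) x.
Proof. exact: smooth_differentiable (oform_smooth _ _ _). Qed.

Lemma form_in_trans i j v x : trd i j x ->
  form_in i alpha v x = form_in j alpha ('d (tr i j) x v) (tr i j x).
Proof.
move=> ijx; rewrite /form_in (cfrom_trans ijx).
have ipx : trd i (pref (cfrom (atlas i) x)) x.
  by case: ijx => cx _; exact: trans_dom_pref.
by congr (alpha _ _); exact: esym (diff_trans_cocycle v ijx ipx).
Qed.

Definition dir_form i u v x : R := 'D_u (form_in i alpha v) x.

Lemma dformE p u v : dform alpha p u v =
  dir_form (pref p) u v (pref_pt p) - dir_form (pref p) v u (pref_pt p).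
Proof. by []. Qed.

Lemma dir_form_linear_r i u (a : R) v w x : ccod (atlas i) x ->
  dir_form i u (a *: v + w) x = a * dir_form i u v x + dir_form i u w x.
Proof.
move=> cx; rewrite /dir_form.
have -> : form_in i alpha (a *: v + w) =
    a \*: form_in i alpha v + form_in i alpha w.
  by apply/funext => y; rewrite form_in_linear.
have dv b : derivable (form_in i alpha b) x u.
  by apply: diff_derivable; exact: form_in_differentiable.
by rewrite deriveD//; [rewrite deriveZ|exact: derivableZ].
Qed.

Lemma dir_form_linear_l i u (a : R) v w x : ccod (atlas i) x ->
  dir_form i (a *: v + w) u x = a * dir_form i v u x + dir_form i w u x.
Proof. by move=> cx; exact: derive_linear_dir (form_in_differentiable _ cx). Qed.

Lemma dform_linear_r p u (a : R) v w :
  dform alpha p u (a *: v + w) = a * dform alpha p u v + dform alpha p u w.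
Proof.
have cp := pref_pt_ccod p.
rewrite !dformE (dir_form_linear_r _ _ _ _ cp) (dir_form_linear_l _ _ _ _ cp).
by rewrite opprD addrACA mulrBr.
Qed.

Lemma dform_skew p u v : dform alpha p u v = - dform alpha p v u.
Proof. by rewrite !dformE opprB. Qed.

Lemma dform_linear_l p (a : R) u w v :
  dform alpha p (a *: u + w) v = a * dform alpha p u v + dform alpha p w v.
Proof.
rewrite (dform_skew p (a *: u + w) v) dform_linear_r.
rewrite (dform_skew p u v) (dform_skew p w v).
rewrite mulrN -opprD.
reflexivity.
Qed.

End Forms.
End Charts.

(** * Invariance of the exterior derivative and the Cartan formula *)

Section Invariance.
Variables (R : realType) (m : nat) (M : smoothManifold R m) (alpha : oneForm M).
Implicit Types (p : M) (i j : atlas_index M) (x v u w : 'rV[R]_m).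

Local Notation tr i j := (trans (atlas i) (atlas j)).
Local Notation trd i j := (trans_dom (atlas i) (atlas j)).
Local Notation e_ k := (delta_mx (0 : 'I_1) k : 'rV[R]_m).

Lemma derive_sum_mul (V : normedModType R) n (f g : 'I_n -> V -> R) (y w : V) :
  (forall k, differentiable (f k) y) -> (forall k, differentiable (g k) y) ->
  'D_w (fun z => \sum_k f k z * g k z) y =
  \sum_k (f k y * 'D_w (g k) y + g k y * 'D_w (f k) y).
Proof.
move=> df dg.
have -> : (fun z => \sum_k f k z * g k z) = \sum_k (f k * g k).
  by apply/funext => z; rewrite fct_sumE.
rewrite derive_sum => [|k]; last first.
  by apply: diff_derivable; exact: differentiableM.
by apply: eq_bigr => k _; rewrite deriveM//; exact: diff_derivable.
Qed.

Lemma trans_coord_smooth i j k : smooth_on (trd i j) (fun y => tr i j y 0 k : R).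
Proof. by apply: smooth_coord; [exact: trans_dom_open|exact: trans_smooth]. Qed.

Lemma derive_comp_trans (f : 'rV[R]_m -> R) i j u x : trd i j x ->
  differentiable f (tr i j x) ->
  'D_u (f \o tr i j) x = 'D_('d (tr i j) x u) f (tr i j x).
Proof.
move=> ijx df; have dT := trans_differentiable ijx.
rewrite deriveE; last exact: differentiable_comp.
by rewrite diff_comp//= deriveE.
Qed.

Definition second_trans i j u v k x : R :=
  'D_u ('D_v (fun y => tr i j y 0 k : R)) x.

Lemma second_trans_sym i j u v k x : trd i j x ->
  second_trans i j u v k x = second_trans i j v u k x.
Proof.
move=> ijx; have sT := @trans_coord_smooth i j k.
apply: (@derive_comm _ _ _ (trd i j)).
- exact: trans_dom_open.
- exact: ijx.
- by move=> y; exact: smooth_differentiable.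
- exact: smooth_differentiable (smooth_derive _ sT) ijx.
- exact: smooth_differentiable (smooth_derive _ sT) ijx.
Qed.

(** Near x, form_in i alpha v is the sum over k of (D_v T_k) (alpha_k o T),
    for T the coordinate change and alpha_k the components of alpha in chart j;
    this is the Leibniz rule. The second summand is symmetric in u and v, and
    so disappears from d alpha. *)
Lemma dir_form_trans i j u v x : trd i j x ->
  dir_form alpha i u v x =
  \sum_k ('d (tr i j) x v 0 k
            * dir_form alpha j ('d (tr i j) x u) (e_ k) (tr i j x)
          + form_in j alpha (e_ k) (tr i j x) * second_trans i j u v k x).
Proof.
move=> ijx; have dT := trans_differentiable ijx.
have cTx : ccod (atlas j) (tr i j x) by have [_ jx] := ijx; exact: cto_cod.
pose f k := 'D_v (fun y => tr i j y 0 k : R).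
pose g k := form_in j alpha (e_ k) \o tr i j.
have N : \near x, form_in i alpha v x = \sum_k f k x * g k x.
  near=> y.
  have ijy : trd i j y by near: y; exact: near_trans_dom.
  rewrite (form_in_trans _ _ ijy) form_in_expand; apply: eq_bigr => k _.
  by congr (_ * _); apply: diff_coord; exact: trans_differentiable.
have df k : differentiable (f k) x.
  exact: smooth_differentiable (smooth_derive _ (@trans_coord_smooth i j k)) ijx.
have dA k := form_in_differentiable alpha (e_ k) cTx.
have dg k : differentiable (g k) x by exact: differentiable_comp.
rewrite /dir_form (near_eq_derive _ N) (derive_sum_mul _ df dg).
apply: eq_bigr => k _.
have E1 : f k x = 'd (tr i j) x v 0 k := esym (diff_coord v k dT).
have E2 := derive_comp_trans u ijx (dA k).
by rewrite [in LHS]E1 [in LHS]E2.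
Unshelve. all: by end_near. Qed.

Lemma dir_form_expand i u v x : ccod (atlas i) x ->
  dir_form alpha i u v x = \sum_k v 0 k * dir_form alpha i u (e_ k) x.
Proof.
move=> cx; apply: (row_linear_expand v (phi := fun v => dir_form alpha i u v x)).
by move=> a w w'; exact: dir_form_linear_r.
Qed.

(** The expression of d alpha in an arbitrary chart, whereas [dform] uses the
    preferred chart of each point. *)
Definition dform_in i u v x : R :=
  dir_form alpha i u v x - dir_form alpha i v u x.

Lemma dform_in_trans i j u v x : trd i j x ->
  dform_in i u v x = dform_in j ('d (tr i j) x u) ('d (tr i j) x v) (tr i j x).
Proof.
move=> ijx.
have cTx : ccod (atlas j) (tr i j x) by have [_ jx] := ijx; exact: cto_cod.
rewrite /dform_in (dir_form_trans u v ijx) (dir_form_trans v u ijx).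
rewrite (dir_form_expand _ ('d (tr i j) x u) cTx).
rewrite (dir_form_expand _ ('d (tr i j) x v) cTx).
rewrite -!sumrB. apply: eq_bigr => k _.
have E (a b c : R) : a + c - (b + c) = a - b by rewrite opprD addrACA subrr addr0.
by rewrite (second_trans_sym u v k ijx); exact: E.
Qed.

Lemma dform_in_jac i u v x : ccod (atlas i) x ->
  dform_in i u v x = dform alpha (cfrom (atlas i) x) (jac i x u) (jac i x v).
Proof. by move=> cx; exact: dform_in_trans (trans_dom_pref cx). Qed.

Lemma dfun_jac (H : smoothFun M) i v x : ccod (atlas i) x ->
  dfun H (cfrom (atlas i) x) (jac i x v) = 'D_v (H \o cfrom (atlas i)) x.
Proof.
move=> cx; have ipx := trans_dom_pref cx; set j := pref _ in ipx *.
have cTx : ccod (atlas j) (tr i j x) by have [_ jx] := ipx; exact: cto_cod.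
have dH : differentiable (H \o cfrom (atlas j)) (tr i j x).
  exact: smooth_differentiable (sfun_smooth _ _) cTx.
rewrite /dfun /pref_chart -/j -[pref_pt _]/(tr i j x) -deriveE//.
rewrite -derive_comp_trans//; apply: near_eq_derive.
near=> y; rewrite /= cfrom_trans//; near: y; exact: near_trans_dom.
Unshelve. all: by end_near. Qed.

Lemma dfun_linear (H : smoothFun M) p (a : R) u v :
  dfun H p (a *: u + v) = a * dfun H p u + dfun H p v.
Proof. by rewrite /dfun linearD linearZ. Qed.

(** Expresses alpha(X) in chart i through smooth components only, although both
    alpha and X are stored with respect to the preferred chart, which may vary
    wildly from point to point. *)
Lemma contraction_in (X : vectorField M) i x : ccod (atlas i) x ->
  alpha (cfrom (atlas i) x) (X (cfrom (atlas i) x)) =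
  \sum_k vf_in i X x 0 k * form_in i alpha (e_ k) x.
Proof. by move=> cx; rewrite -jac_vf_in// -form_in_jac form_in_expand. Qed.

Lemma vf_in_coord_smooth (X : vectorField M) i k :
  smooth_on (ccod (atlas i)) (fun x => vf_in i X x 0 k : R).
Proof. by apply: smooth_coord (vfield_smooth _ _); exact: ccod_open. Qed.

Lemma contraction_smooth (X : vectorField M) : is_smooth (fun p => alpha p (X p)).
Proof.
move=> i.
have oc : open (ccod (atlas i)) by exact: ccod_open.
apply: smooth_ext (fun x => @esym _ _ _ \o @contraction_in X i x) _ => //.
apply: smooth_sum => // k; apply: smooth_mul => //; last exact: oform_smooth.
exact: vf_in_coord_smooth.
Qed.

Definition contraction (X : vectorField M) : smoothFun M :=
  SmoothFun (contraction_smooth X).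

(** Same principle as for [contraction_smooth]: in chart i the derivative of H
    along X is a combination of smooth components and partial derivatives. *)
Lemma dfun_field_smooth (H : smoothFun M) (X : vectorField M) :
  is_smooth (fun p => dfun H p (X p)).
Proof.
move=> i; have oc : open (ccod (atlas i)) by exact: ccod_open.
apply: (@smooth_ext _ _ _ _ (fun x => \sum_k vf_in i X x 0 k
    * 'D_(e_ k) (H \o cfrom (atlas i)) x)) => //.
  move=> x cx /=; rewrite -jac_vf_in// dfun_jac//.
  rewrite (row_linear_expand (vf_in i X x)
    (phi := fun v => 'D_v (H \o cfrom (atlas i)) x))// => a u w.
  apply: derive_linear_dir.
  exact: smooth_differentiable (sfun_smooth _ _) cx.
apply: smooth_sum => // k; apply: smooth_mul => //.
  exact: vf_in_coord_smooth.
by apply: smooth_derive; exact: sfun_smooth.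
Qed.

Lemma derive_vf_in_coord (X : vectorField M) i v x k : ccod (atlas i) x ->
  ('D_v (vf_in i X) x : 'rV[R]_m) 0 k = 'D_v (fun y => vf_in i X y 0 k : R) x.
Proof.
move=> cx; have dX := smooth_differentiable (@vfield_smooth _ _ _ X i) cx.
rewrite derive_mx ?mxE//; exact: diff_derivable.
Qed.

Lemma dfun_contraction (X : vectorField M) p v :
  dfun (contraction X) p v = dir_form alpha (pref p) v (X p) (pref_pt p)
    + alpha p ('D_v (vf_in (pref p) X) (pref_pt p)).
Proof.
have cp := pref_pt_ccod p.
have sX k := @vf_in_coord_smooth X (pref p) k.
have dX k : differentiable (fun x => vf_in (pref p) X x 0 k : R) (pref_pt p).
  exact: smooth_differentiable (sX k) cp.
have dA k : differentiable (form_in (pref p) alpha (e_ k)) (pref_pt p).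
  exact: form_in_differentiable.
have -> : dfun (contraction X) p v =
    'D_v (contraction X \o cfrom (atlas (pref p))) (pref_pt p).
  by rewrite -dfun_jac// cfrom_pref_pt jac_pref.
have N : \forall y \near pref_pt p, (contraction X \o cfrom (atlas (pref p))) y =
    \sum_k vf_in (pref p) X y 0 k * form_in (pref p) alpha (e_ k) y.
  by apply: filterS (open_near (@ccod_open _ _ _ _) cp) => x; exact: contraction_in.
rewrite (near_eq_derive _ N) (derive_sum_mul _ dX dA) big_split/=.
congr (_ + _).
  by rewrite (dir_form_expand _ _ cp) vf_in_pref.
rewrite -[RHS]form_in_pref form_in_expand; apply: eq_bigr => k _.
by rewrite (derive_vf_in_coord X v k cp) mulrC.
Qed.

(** By the Leibniz rule for the components of alpha and X, d (alpha(X)) (v) is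
    the derivative along v of alpha on the constant vector X(p), plus alpha on
    the derivative of X along v. The former cancels against d alpha (X, v) and
    leaves the Lie derivative. *)
Lemma lie_derivative_cartan (X : vectorField M) p v :
  lie_derivative X alpha p v = dform alpha p (X p) v + dfun (contraction X) p v.
Proof. by rewrite dfun_contraction dformE addrA subrK. Qed.

End Invariance.

(** * Alternating forms of top degree *)

Section Multilinear.
Variables (R : realType) (V : lmodType R).
Implicit Types (k l : nat) (u v : V).

Definition replace_arg k (w : 'I_k -> V) (j : 'I_k) (u : V) : 'I_k -> V :=
  fun i => if i == j then u else w i.

Definition multilinear k (f : multiform R V k) : Prop :=
  forall w j (a : R) u v,
    f (replace_arg w j (a *: u + v)) =
    a * f (replace_arg w j u) + f (replace_arg w j v).

(** Skew-symmetry under all permutations; in characteristic zero it forces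
    vanishing on repeated arguments ([skew_repeated_arg]). *)
Definition skew k (f : multiform R V k) : Prop :=
  forall w (s : 'S_k), f (w \o s) = (-1) ^+ odd_perm s * f w.

Definition killed_by v k (f : multiform R V k) : Prop :=
  forall w j, f (replace_arg w j v) = 0.

Lemma replace_arg_id k (w : 'I_k -> V) j : replace_arg w j (w j) = w.
Proof. by apply/funext => i; rewrite /replace_arg; case: eqP => // ->. Qed.

Lemma multilinear_sum k (f : multiform R V k) (I : Type) (r : seq I)
    (c : I -> R) (e : I -> V) w j : multilinear f ->
  f (replace_arg w j (\sum_(i <- r) c i *: e i)) =
  \sum_(i <- r) c i * f (replace_arg w j (e i)).
Proof.
move=> mf; elim: r => [|i r IH]; last by rewrite !big_cons mf IH.
have := mf w j (-1) 0 0; rewrite !big_nil scaler0 addr0 mulN1r addNr.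
by [].
Qed.

Lemma skew_repeated_arg k (f : multiform R V k) w (i j : 'I_k) :
  skew f -> i != j -> w i = w j -> f w = 0.
Proof.
move=> sf ij wij.
have := sf w (tperm i j); rewrite odd_tperm ij expr1 mulN1r.
have -> : w \o tperm i j = w.
  by apply/funext => x /=; case: tpermP => [->|->|].
move=> /eqP; rewrite -addr_eq0 -mulr2n mulrn_eq0/= => /eqP; exact.
Qed.

(** All terms other than the j-th repeat an argument. *)
Lemma skew_replace_arg_comb k (f : multiform R V k) w j (c : 'I_k -> R) :
  multilinear f -> skew f -> f (replace_arg w j (\sum_i c i *: w i)) = c j * f w.
Proof.
move=> mf sf; rewrite multilinear_sum// (bigD1 j)//= replace_arg_id.
rewrite big1 ?addr0// => i ij.
by rewrite (@skew_repeated_arg _ _ _ i j) ?mulr0// /replace_arg eqxx (negbTE ij).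
Qed.

(** The wedge product is a signed sum over all permutations, so precomposing
    by t only reindexes the sum. *)
Lemma wedge_skew k l (a : multiform R V k) (b : multiform R V l) :
  skew (wedge a b).
Proof.
move=> w t; rewrite /wedge mulrCA; congr (_ * _).
rewrite mulr_sumr (reindex_inj (mulIg t^-1%g))/=.
apply: eq_bigr => s _.
rewrite odd_permM odd_permV signr_addb [_ * (-1) ^+ t]mulrC.
rewrite -[LHS]mulrA; congr (_ * (_ * (a _ * b _))).
all: apply/funext => i /=.
all: by rewrite permM permKV.
Qed.

(** In each term of a wedge product, a given argument is fed to exactly one slot
    of exactly one of the two factors. *)
Lemma wedge_slot k l (s : 'S_(k + l)) (j : 'I_(k + l)) (w : 'I_(k + l) -> V) :
  (exists i0, forall u,
    (fun i => replace_arg w j u (s (lshift l i)))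
      = replace_arg (fun i => w (s (lshift l i))) i0 u /\
    (fun i => replace_arg w j u (s (rshift k i))) = (fun i => w (s (rshift k i)))) \/
  (exists i0, forall u,
    (fun i => replace_arg w j u (s (lshift l i))) = (fun i => w (s (lshift l i))) /\
    (fun i => replace_arg w j u (s (rshift k i)))
      = replace_arg (fun i => w (s (rshift k i))) i0 u).
Proof.
rewrite -(permKV s j); set x := (s^-1)%g j.
case: (split_ordP x) => i ->; [left|right]; exists i => u; split;
  apply/funext => i'; rewrite /replace_arg (inj_eq perm_inj).
- by rewrite (inj_eq (@lshift_inj _ _)).
- by rewrite eq_rlshift.
- by rewrite eq_lrshift.
- by rewrite (inj_eq (@rshift_inj _ _)).
Qed.

Lemma wedge_multilinear k l (a : multiform R V k) (b : multiform R V l) :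
  multilinear a -> multilinear b -> multilinear (wedge a b).
Proof.
move=> ma mb w j c u v; rewrite /wedge [c * _]mulrCA -mulrDr; congr (_ * _).
rewrite mulr_sumr -big_split/=; apply: eq_bigr => s _.
rewrite [c * _]mulrCA -mulrDr; congr (_ * _).
case: (wedge_slot s j w) => -[i E]; rewrite !(E _).1 !(E _).2.
  by rewrite ma mulrDl mulrA.
by rewrite mb mulrDr mulrCA.
Qed.

Lemma wedge_killed v k l (a : multiform R V k) (b : multiform R V l) :
  killed_by v a -> killed_by v b -> killed_by v (wedge a b).
Proof.
move=> ka kb w j; rewrite /wedge big1 ?mulr0// => s _.
by case: (wedge_slot s j w) => -[i E];
  rewrite (E _).1 (E _).2 ?ka ?kb ?mul0r ?mulr0.
Qed.

Lemma wedge_exp_multilinear k (a : multiform R V k) n :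
  multilinear a -> multilinear (wedge_exp a n).
Proof.
move=> ma; elim: n => [|n IH]; first by move=> w [].
exact: wedge_multilinear.
Qed.

Lemma wedge_exp_killed v k (a : multiform R V k) n :
  killed_by v a -> killed_by v (wedge_exp a n).
Proof.
by move=> ka; elim: n => [|n IH]; [move=> w []|exact: wedge_killed].
Qed.

End Multilinear.

(** Some nontrivial linear relation holds between the arguments w_i and v:
    either the w_i span the space, and v = sum_i c_i w_i with c nonzero, or
    they are dependent, and 0 = sum_i c_i w_i with c nonzero. Replacing an
    argument w_j with c_j nonzero by this combination multiplies f w by c_j,
    but gives f (.., v, ..) or f (.., 0, ..), both of which vanish. *)
Lemma top_form_killed (R : realType) (m k : nat) (f : multiform R 'rV[R]_m k)
    (v : 'rV[R]_m) : (m <= k)%N -> v != 0 ->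
  multilinear f -> skew f -> killed_by v f -> forall w, f w = 0.
Proof.
move=> mk v0 mf sf kf w.
pose W := \matrix_i w i.
have [c [c0 cv]] : exists c : 'rV[R]_k, c != 0 /\ (c *m W = v \/ c *m W = 0).
  have [/(submx_full v)/submxP[c vc]|nf] := boolP (row_full W).
    exists c; split; last by left.
    by apply: contraNneq v0 => c0; rewrite vc c0 mul0mx.
  have : kermx W != 0.
    rewrite kermx_eq0; apply: contra nf => /eqP rk.
    by rewrite /row_full eqn_leq rank_leq_col/= rk.
  by case/rowV0Pn => c /sub_kermxP cW c0; exists c; split => //; right.
have [j cj] : exists j, c 0 j != 0.
  by apply/existsP; apply: contraNT c0 => /existsPn c0;
    apply/eqP/rowP => j; rewrite mxE; apply/eqP; have := c0 j; rewrite negbK.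
have := skew_replace_arg_comb w j (c 0) mf sf.
have -> : \sum_i c 0 i *: w i = c *m W.
  by rewrite mulmx_sum_row; apply: eq_bigr => i _; rewrite rowK.
have -> : f (replace_arg w j (c *m W)) = 0.
  case: cv => ->; first exact: kf.
  by have := multilinear_sum [::] (c 0) w w j mf; rewrite !big_nil.
by move=> /esym/eqP; rewrite mulf_eq0 (negbTE cj) => /eqP.
Qed.

(** * Hamiltonian fields on a contact manifold *)

Lemma smoothFun_ext (R : realType) m (M : smoothManifold R m)
  (f g : smoothFun M) :
  (forall p, f p = g p) -> f = g.
Proof.
case: f g => [f sf] [g sg] /= /funext fg; case: _ / fg sg => sg.
by rewrite (Prop_irrelevance sf sg).
Qed.

Lemma vectorField_ext (R : realType) m (M : smoothManifold R m)
  (X Y : vectorField M) : (forall p, X p = Y p) -> X = Y.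
Proof.
case: X Y => [X sX] [Y sY] /= /funext XY; case: _ / XY sY => sY.
by rewrite (Prop_irrelevance sX sY).
Qed.

Lemma ord2_cases (j : 'I_2) : j = ord0 \/ j = ord_max.
Proof. by case: j => -[|[|//]] ?; [left|right]; apply: val_inj. Qed.

Section ContactLinearAlgebra.
Variables (R : realType) (n : nat) (M : smoothManifold R n.*2.+1).
Variables (alpha : oneForm M) (Rb : vectorField M).
Hypothesis (alpha_contact : is_contact_form alpha).
Hypothesis (Rb_reeb : is_reeb alpha Rb).
Implicit Types (p : M) (i : atlas_index M) (H : smoothFun M)
  (x u v w : 'rV[R]_n.*2.+1) (X Y : vectorField M).

Local Notation e_ k := (delta_mx (0 : 'I_1) k : 'rV[R]_n.*2.+1).

Lemma form1_multilinear p : multilinear (form1 alpha p).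
Proof. by move=> w j a u v; rewrite /form1 /replace_arg !ord1 eqxx oform_linear. Qed.

Lemma form2_multilinear p : multilinear (form2 alpha p).
Proof.
move=> w j a u v; rewrite /form2 /replace_arg.
have [->|->] := ord2_cases j.
- by rewrite eqxx /=; exact: dform_linear_l.
- by rewrite eqxx /=; exact: dform_linear_r.
Qed.

Lemma form2_killed p v : (forall w, dform alpha p v w = 0) ->
  killed_by v (form2 alpha p).
Proof.
move=> v0 w j; rewrite /form2 /replace_arg.
have [->|->] := ord2_cases j.
- by rewrite eqxx /=; exact: v0.
- by rewrite eqxx /= dform_skew v0 oppr0.
Qed.

(** Otherwise v would kill alpha /\ (d alpha)^n, a form of top degree, which
    would then vanish at p. *)
Lemma contact_nondegenerate p v :
  alpha p v = 0 -> (forall w, dform alpha p v w = 0) -> v = 0.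
Proof.
move=> av dv; apply/eqP; apply/negPn/negP => v0.
have [w /negP] := alpha_contact p; apply; apply/eqP.
apply: (top_form_killed _ v0) => //.
- by rewrite add1n muln2.
- by apply: wedge_multilinear; [exact: form1_multilinear|
    apply: wedge_exp_multilinear; exact: form2_multilinear].
- exact: wedge_skew.
- apply: wedge_killed; last by apply: wedge_exp_killed; exact: form2_killed.
  by move=> w' j; rewrite /form1 /replace_arg !ord1 eqxx.
Qed.

(** The symmetric term alpha(u) alpha(v) makes up for the kernel of d alpha,
    which is spanned by the Reeb direction. *)
Definition contact_pairing p u v : R :=
  alpha p u * alpha p v + dform alpha p u v.

(** The sum of H alpha and the right-hand side of the second Hamilton condition:
    adding alpha(X) alpha = H alpha to that condition merges both conditions
    into the single linear equation [contact_pairing] (X, .) = this covector. *)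
Definition hamilton_covector H p v : R :=
  H p * alpha p v + (dfun H p (Rb p) * alpha p v - dfun H p v).

Lemma contact_pairing_linear_l p (a : R) u v w :
  contact_pairing p (a *: u + v) w =
  a * contact_pairing p u w + contact_pairing p v w.
Proof.
rewrite /contact_pairing oform_linear dform_linear_l.
by rewrite mulrDl [in RHS]mulrDr !mulrA addrACA.
Qed.

Lemma contact_pairing_linear_r p (a : R) u v w :
  contact_pairing p w (a *: u + v) =
  a * contact_pairing p w u + contact_pairing p w v.
Proof.
rewrite /contact_pairing oform_linear dform_linear_r.
by rewrite [in LHS]mulrDr [in RHS]mulrDr mulrCA addrACA.
Qed.

Lemma hamilton_covector_linear H p (a : R) u v :
  hamilton_covector H p (a *: u + v)
  = a * hamilton_covector H p u + hamilton_covector H p v.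
Proof.
have E (h r b c d e : R) : h * (a * b + c) + (r * (a * b + c) - (a * d + e)) =
   a * (h * b + (r * b - d)) + (h * c + (r * c - e)) by ring.
by rewrite /hamilton_covector oform_linear dfun_linear E.
Qed.

Lemma contact_pairing_reeb p v : contact_pairing p v (Rb p) = alpha p v.
Proof.
have [R0 R1] := Rb_reeb p.
by rewrite /contact_pairing R1 mulr1 dform_skew R0 oppr0 addr0.
Qed.

(** Pairing u with the Reeb vector shows alpha(u) = 0, and then the pairing
    reduces to d alpha. *)
Lemma contact_pairing_nondegenerate p u :
  (forall v, contact_pairing p u v = 0) -> u = 0.
Proof.
move=> u0; have au : alpha p u = 0 by rewrite -contact_pairing_reeb u0.
apply: (contact_nondegenerate au) => w.
by have := u0 w; rewrite /contact_pairing au mul0r add0r.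
Qed.

Definition gram i x : 'M[R]_n.*2.+1 := \matrix_(j, k)
  contact_pairing (cfrom (atlas i) x) (jac i x (e_ j)) (jac i x (e_ k)).

Definition hamilton_row H i x : 'rV[R]_n.*2.+1 :=
  \row_k hamilton_covector H (cfrom (atlas i) x) (jac i x (e_ k)).

Lemma mul_gram i x w k : (w *m gram i x) 0 k =
  contact_pairing (cfrom (atlas i) x) (jac i x w) (jac i x (e_ k)).
Proof.
rewrite (row_linear_expand w (phi := fun w =>
  contact_pairing (cfrom (atlas i) x) (jac i x w) (jac i x (e_ k)))).
  by rewrite mxE; apply: eq_bigr => j _; rewrite !mxE.
by move=> a u v; rewrite linearD linearZ; exact: contact_pairing_linear_l.
Qed.

Lemma linear_forms_eq i x (f g : 'rV[R]_n.*2.+1 -> R) : ccod (atlas i) x ->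
  (forall a u v, f (a *: u + v) = a * f u + f v) ->
  (forall a u v, g (a *: u + v) = a * g u + g v) ->
  (forall k, f (jac i x (e_ k)) = g (jac i x (e_ k))) -> f =1 g.
Proof.
move=> cx lf lg fg v; have [u <-] := jac_surj v cx.
rewrite (row_linear_expand u (phi := fun u => f (jac i x u))); last first.
  by move=> a w w'; rewrite linearD linearZ; exact: lf.
rewrite (row_linear_expand u (phi := fun u => g (jac i x u))); last first.
  by move=> a w w'; rewrite linearD linearZ; exact: lg.
by apply: eq_bigr => k _; rewrite fg.
Qed.

(** Translates a linear equation for the pairing into a matrix equation in chart
    i; it is used in both directions, to build the solution in the preferred
    chart and to recognize it in all others. *)
Lemma mul_gramP i x w (f : 'rV[R]_n.*2.+1 -> R) : ccod (atlas i) x ->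
  (forall a u v, f (a *: u + v) = a * f u + f v) ->
  w *m gram i x = \row_k f (jac i x (e_ k)) <->
  forall v, contact_pairing (cfrom (atlas i) x) (jac i x w) v = f v.
Proof.
move=> cx lf; split=> [E|E].
  apply: (linear_forms_eq cx) => // [a u v|k].
    exact: contact_pairing_linear_r.
  by rewrite -mul_gram E mxE.
by apply/rowP => k; rewrite mul_gram E mxE.
Qed.

Lemma gram_unit i x : ccod (atlas i) x -> gram i x \in unitmx.
Proof.
move=> cx; rewrite -row_free_unit; apply: inj_row_free => w w0.
apply: (jac_inj cx); apply: contact_pairing_nondegenerate.
apply/(mul_gramP w (f := fun=> 0) cx) => [a u v|]; first by rewrite mulr0 addr0.
by rewrite w0; apply/rowP => k; rewrite !mxE.
Qed.

Lemma gram_smooth i j k : smooth_on (ccod (atlas i)) (fun x => gram i x j k).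
Proof.
have oc : open (ccod (atlas i)) by exact: ccod_open.
apply: (@smooth_ext _ _ _ _ (fun x =>
  form_in i alpha (e_ j) x * form_in i alpha (e_ k) x
  + dform_in alpha i (e_ j) (e_ k) x)) => //.
  by move=> x cx; rewrite mxE /contact_pairing dform_in_jac.
have sa l : smooth_on (ccod (atlas i)) (form_in i alpha (e_ l)).
  exact: oform_smooth.
apply: smooth_add => //; first exact: smooth_mul.
by apply: smooth_sub => //; exact: smooth_derive.
Qed.

Lemma hamilton_row_smooth H i k :
  smooth_on (ccod (atlas i)) (fun x => hamilton_row H i x 0 k).
Proof.
have oc : open (ccod (atlas i)) by exact: ccod_open.
have sa : smooth_on (ccod (atlas i)) (form_in i alpha (e_ k)).
  exact: oform_smooth.
apply: (@smooth_ext _ _ _ _ (fun x =>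
  (H \o cfrom (atlas i)) x * form_in i alpha (e_ k) x
  + (((fun p => dfun H p (Rb p)) \o cfrom (atlas i)) x * form_in i alpha (e_ k) x
     - 'D_(e_ k) (H \o cfrom (atlas i)) x))) => //.
  by move=> x cx; rewrite mxE /hamilton_covector dfun_jac.
have sH : smooth_on (ccod (atlas i)) (H \o cfrom (atlas i)) by exact: sfun_smooth.
apply: smooth_add => //; first exact: smooth_mul.
apply: smooth_sub => //; last exact: smooth_derive.
by apply: smooth_mul => //; exact: dfun_field_smooth.
Qed.

Definition hamilton_solution H i x : 'rV[R]_n.*2.+1 :=
  hamilton_row H i x *m invmx (gram i x).

(** The solution is computed in the preferred chart of each point;
    [vf_in_hamilton] shows that by uniqueness the same formula holds in
    every chart, which is what makes it smooth. *)
Definition hamilton_vect H p := hamilton_solution H (pref p) (pref_pt p).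

Lemma hamilton_vectP H p v :
  contact_pairing p (hamilton_vect H p) v = hamilton_covector H p v.
Proof.
have cp := pref_pt_ccod p.
have := mul_gramP (hamilton_vect H p) cp (hamilton_covector_linear H p).
rewrite cfrom_pref_pt jac_pref => -[+ _]; apply.
rewrite [LHS](mulmxKV (gram_unit cp)) /hamilton_row cfrom_pref_pt.
by [].
Qed.

Lemma vf_in_hamilton H i x : ccod (atlas i) x ->
  vf_in i (hamilton_vect H) x = hamilton_solution H i x.
Proof.
move=> cx; rewrite /hamilton_solution.
apply: (canRL (mulmxK (gram_unit cx))).
apply/(mul_gramP _ cx (hamilton_covector_linear H (cfrom (atlas i) x))) => v.
by rewrite jac_vf_in// hamilton_vectP.
Qed.

Lemma hamilton_vect_smooth H i :
  smooth_on (ccod (atlas i)) (vf_in i (hamilton_vect H)).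
Proof.
have oc : open (ccod (atlas i)) by exact: ccod_open.
apply: (@smooth_ext _ _ _ _ (hamilton_solution H i)) => //.
  by move=> x cx; rewrite vf_in_hamilton.
apply: smooth_mx => // j k; rewrite ord1.
apply: smooth_mulmx => // [{}j l|].
  by rewrite ord1; exact: hamilton_row_smooth.
by apply: smooth_invmx => //; [exact: gram_unit|exact: gram_smooth].
Qed.

Definition hamilton_field H : vectorField M :=
  VectorField (hamilton_vect_smooth H).

(** Evaluating the linear equation on the Reeb vector leaves alpha(X) = H, since
    the terms in dH(R) cancel; subtracting H alpha from it gives the rest. *)
Lemma hamilton_field_is_hamiltonian H :
  is_hamiltonian_field alpha Rb H (hamilton_field H).
Proof.
move=> p; have E := hamilton_vectP H p.
have [R0 R1] := Rb_reeb p.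
have aH : alpha p (hamilton_field H p) = H p.
  rewrite -contact_pairing_reeb [LHS]E /hamilton_covector R1 !mulr1.
  by rewrite subrr addr0.
split=> // v; have := E v.
by rewrite /contact_pairing /hamilton_covector [alpha p _]aH => /addrI.
Qed.

Lemma hamiltonian_unique H X Y :
  is_hamiltonian_field alpha Rb H X -> is_hamiltonian_field alpha Rb H Y -> X = Y.
Proof.
move=> hX hY; apply: vectorField_ext => p.
have [aX dX] := hX p; have [aY dY] := hY p.
apply/eqP; rewrite -subr_eq0 addrC -scaleN1r; apply/eqP.
apply: (@contact_nondegenerate p) => [|w].
  by rewrite oform_linear aX aY mulN1r addNr.
by rewrite dform_linear_l dX dY mulN1r addNr.
Qed.

(** The conformal factor of X is dH(R), where R is the Reeb field. *)
Lemma hamiltonian_contact H X :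
  is_hamiltonian_field alpha Rb H X -> is_contact_field alpha X.
Proof.
move=> hX; exists (SmoothFun (dfun_field_smooth H Rb)) => p v.
have EH : contraction alpha X = H by apply: smoothFun_ext => q; have [] := hX q.
by rewrite lie_derivative_cartan EH /=; have [_ ->] := hX p; rewrite subrK.
Qed.

(** The conformal factor of X is forced to be dH(R) by evaluating the Cartan
    formula on the Reeb vector R. *)
Lemma contact_hamiltonian X : is_contact_field alpha X ->
  is_hamiltonian_field alpha Rb (contraction alpha X) X.
Proof.
move=> [mu hmu] p; split=> // v.
have [R0 R1] := Rb_reeb p.
have := hmu p (Rb p).
rewrite lie_derivative_cartan dform_skew R0 oppr0 add0r R1 mulr1 => ->.
by rewrite -hmu lie_derivative_cartan addrK.
Qed.

End ContactLinearAlgebra.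

Theorem theorem3p1p1 (R : realType) (n : nat) (M : smoothManifold R n.*2.+1)
    (alpha : oneForm M) (Rb : vectorField M)
    (alpha_contact : is_contact_form alpha) (Rb_reeb : is_reeb alpha Rb) :
  exists (HX : contactField alpha -> smoothFun M)
         (XH : smoothFun M -> contactField alpha),
    [/\ (forall (X : contactField alpha) (p : M),
           HX X p = alpha p (sval X p)),
        (forall (H : smoothFun M) (Y : vectorField M),
           is_hamiltonian_field alpha Rb H Y <-> Y = sval (XH H)),
        cancel HX XH
      & cancel XH HX].
Proof.
have hH H := hamilton_field_is_hamiltonian alpha_contact Rb_reeb H.
exists (fun X => contraction alpha (sval X)).
exists (fun H => exist _ _ (hamiltonian_contact (hH H))).
split=> [//|H Y /=|[X cX]|H].
- by split=> [hY|->//]; exact: hamiltonian_unique hY (hH H).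
- apply: eq_exist => /=; apply: (hamiltonian_unique alpha_contact) (hH _) _.
  exact: contact_hamiltonian.
- by apply: smoothFun_ext => p; have [] := hH H p.
Qed.
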